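(* Let $G$ be a profinite group with $\mathrm{VZ}(G)=\{1\}$, and suppose $G$ contains a non-trivial closed normal subgroup $N$ with the following properties: (i) $N$ is sticky in $G$; (ii) $N$ has non-trivial centralizer in $G$. Then $G$ does not have a compactly generated, topologically simple envelope.
   Context: For a topological group $L$, the virtual center is $\mathrm{VZ}(L)=\{g\in L: \text{the centralizer of } g \text{ in } L \text{ is open in } L\}$. Commensurator of a profinite group $G$: a virtual automorphism of $G$ is a topological isomorphism between two open subgroups of $G$; two are equivalent if they coincide on some open subgroup; the equivalence classes form, under composition (after restricting to suitable open subgroups), a group $\mathrm{Comm}(G)$. The homomorphism $\iota_G:G\to\mathrm{Comm}(G)$ sends $g$ to the class of conjugation $x\mapsto gxg^{-1}$; its kernel is $\mathrm{VZ}(G)$, so when $\mathrm{VZ}(G)=\{1\}$ we regard $G$ as a subgroup of $\mathrm{Comm}(G)$ via $\iota_G$. Let $G$ be a profinite group with trivial virtual center. A closed subgroup $N$ of $G$ is called sticky if $N\cap gNg^{-1}$ has finite index in both $N$ and $gNg^{-1}$ for every $g\in\mathrm{Comm}(G)$. An envelope of a profinite group $G$ is a pair $(L,\eta)$ where $L$ is a topological group and $\eta:G\to L$ is an injective homomorphism such that $\eta(G)$ is open in $L$ and $\eta$ is a homeomorphism onto $\eta(G)$. An envelope is said to be compactly generated (generated by a compact subset) or topologically simple (non-trivial, with no closed normal subgroups other than $\{1\}$ and itself) if $L$ is. *)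

(* Defs.v *)
From HB Require Import structures.
From mathcomp Require Import all_boot generic_quotient.
From mathcomp Require Import boolp classical_sets functions cardinality.
From mathcomp Require Import topology.

Set Implicit Arguments.
Unset Strict Implicit.
Unset Printing Implicit Defensive.

Local Open Scope classical_set_scope.
Local Open Scope group_scope.
Local Open Scope quotient_scope.

HB.mixin Record Group_isTopologicalGroup G of Topological G & Group G := {
  mulg_continuous : continuous (fun x : G * G => x.1 * x.2) ;
  invg_continuous : continuous (fun x : G => x^-1)
}.

#[short(type="topologicalGroupType")]
HB.structure Definition TopologicalGroup :=
  {G of Topological G & Group G & Group_isTopologicalGroup G}.

Definition subgroup (G : groupType) (H : set G) : Prop := group_closed (mem H).

Definition conjset (G : groupType) (g : G) (A : set G) : set G :=
  [set g * x * g^-1 | x in A].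

Definition normal_subgroup (G : groupType) (N : set G) : Prop :=
  subgroup N /\ forall g, conjset g N = N.

Definition centralizer (G : groupType) (A : set G) : set G :=
  [set g | forall x, A x -> commute g x].

(* Finitely many left cosets kH with k in K; meant for subgroups H of K. *)
Definition finite_index (G : groupType) (H K : set G) : Prop :=
  finite_set [set [set k * h | h in H] | k in K].

Definition VZ (L : topologicalGroupType) : set L :=
  [set g | open (centralizer [set g])].
Arguments VZ : clear implicits.

Definition profinite (G : topologicalGroupType) : Prop :=
  [/\ compact [set: G], hausdorff_space G & totally_disconnected [set: G]].

Definition homeomorphism_on (S T : topologicalType) (U : set S) (V : set T)
    (f : S -> T) (g : T -> S) : Prop :=
  [/\ f @` U `<=` V /\ g @` V `<=` U,
      {in U, cancel f g} /\ {in V, cancel g f},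
      {within U, continuous f} & {within V, continuous g}].

(* The values of vfun outside vdom and of vinv outside vcod are junk. *)
Record vaut (G : topologicalGroupType) := Vaut {
  vdom : set G;
  vcod : set G;
  vfun : G -> G;
  vinv : G -> G;
  vdom_open_subgroup : open vdom /\ subgroup vdom;
  vcod_open_subgroup : open vcod /\ subgroup vcod;
  vfun_morph : {in vdom &, {morph vfun : x y / x * y}};
  vfun_homeo : homeomorphism_on vdom vcod vfun vinv
}.

Definition veq (G : topologicalGroupType) (phi psi : vaut G) : Prop :=
  exists W : set G, [/\ open W, subgroup W, W `<=` vdom phi `&` vdom psi
                      & {in W, vfun phi =1 vfun psi}].

Section Subgroups.
Variable G : groupType.
Implicit Types H K : set G.

Lemma subgroupP H : subgroup H <->
  [/\ H 1, (forall x y, H x -> H y -> H (x * y)) & (forall x, H x -> H x^-1)].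
Proof.
split=> [sH|[H1 HM HV]].
  split=> [|x y Hx Hy|x Hx]; apply: set_mem.
  - exact: sH.1.
  - by apply: (group_closedM sH); rewrite mem_set.
  - by apply: (group_closedV sH); rewrite mem_set.
split; first exact: mem_set.
by move=> x y /set_mem Hx /set_mem Hy; apply/mem_set/HM => //; apply: HV.
Qed.

Lemma subgroupT : subgroup [set: G].
Proof. by apply/subgroupP. Qed.

Lemma subgroupI H K : subgroup H -> subgroup K -> subgroup (H `&` K).
Proof.
move=> /subgroupP[H1 HM HV] /subgroupP[K1 KM KV]; apply/subgroupP.
split=> // [x y [? ?] [? ?]|x [? ?]].
  by split; [apply: HM|apply: KM].
by split; [apply: HV|apply: KV].
Qed.

End Subgroups.

Section VirtualAutomorphisms.
Variable G : topologicalGroupType.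
Implicit Types (phi psi : vaut G) (g x y : G).

Lemma vdom_subgroup phi : subgroup (vdom phi).
Proof. by case: (vdom_open_subgroup phi). Qed.

Lemma vcod_subgroup phi : subgroup (vcod phi).
Proof. by case: (vcod_open_subgroup phi). Qed.

Lemma vdom_open phi : open (vdom phi).
Proof. by case: (vdom_open_subgroup phi). Qed.

Lemma vcod_open phi : open (vcod phi).
Proof. by case: (vcod_open_subgroup phi). Qed.

Lemma vfun_cod phi x : vdom phi x -> vcod phi (vfun phi x).
Proof. by case: (vfun_homeo phi) => -[h _] _ _ _ ?; apply: h; exists x. Qed.

Lemma vinv_dom phi x : vcod phi x -> vdom phi (vinv phi x).
Proof. by case: (vfun_homeo phi) => -[_ h] _ _ _ ?; apply: h; exists x. Qed.

Lemma vfunK phi x : vdom phi x -> vinv phi (vfun phi x) = x.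
Proof. by case: (vfun_homeo phi) => _ [h _] _ _ ?; rewrite h ?mem_set. Qed.

Lemma vinvK phi x : vcod phi x -> vfun phi (vinv phi x) = x.
Proof. by case: (vfun_homeo phi) => _ [_ h] _ _ ?; rewrite h ?mem_set. Qed.

Lemma vfunM phi x y : vdom phi x -> vdom phi y ->
  vfun phi (x * y) = vfun phi x * vfun phi y.
Proof. by move=> ? ?; rewrite vfun_morph ?mem_set. Qed.

Lemma vinvM phi x y : vcod phi x -> vcod phi y ->
  vinv phi (x * y) = vinv phi x * vinv phi y.
Proof.
have /subgroupP[_ UM _] := vdom_subgroup phi.
move=> Vx Vy; have Ux := vinv_dom Vx; have Uy := vinv_dom Vy.
by rewrite -[in LHS](vinvK Vx) -[in LHS](vinvK Vy) -vfunM// vfunK//; apply: UM.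
Qed.

Lemma morph_on1V (A : set G) (f : G -> G) : subgroup A ->
    (forall x y, A x -> A y -> f (x * y) = f x * f y) ->
  f 1 = 1 /\ forall x, A x -> f x^-1 = (f x)^-1.
Proof.
move=> /subgroupP[A1 _ AV] fM.
have f1 : f 1 = 1 by apply: (@mulgI _ (f 1)); rewrite -fM// !mulg1.
split=> // x Ax; apply: (@mulgI _ (f x)).
by rewrite -fM ?mulgV//; exact: AV.
Qed.

Lemma subgroup_preim (A B : set G) (f : G -> G) : subgroup A -> subgroup B ->
    (forall x y, A x -> A y -> f (x * y) = f x * f y) ->
  subgroup (A `&` f @^-1` B).
Proof.
move=> sA sB fM; have [f1 fV] := morph_on1V sA fM.
move/subgroupP: sA => [A1 AM AV]; move/subgroupP: sB => [B1 BM BV].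
apply/subgroupP; split=> [|x y [Ax Bx] [Ay By]|x [Ax Bx]]; split=> //=.
- by rewrite f1.
- exact: AM.
- by rewrite fM//; apply: BM.
- exact: AV.
- by rewrite fV//; apply: BV.
Qed.

Lemma open_preim (S T : topologicalType) (A : set S) (B : set T) (f : S -> T) :
  open A -> open B -> {within A, continuous f} -> open (A `&` f @^-1` B).
Proof.
move=> oA oB; rewrite continuous_open_subspace// => cf.
rewrite openE => x [Ax Bx]; apply: filterI; first exact: open_nbhs_nbhs.
by apply: cf; [exact: mem_set|exact: open_nbhs_nbhs].
Qed.

Lemma within_comp (S T V : topologicalType) (A : set S) (B : set T)
    (f : S -> T) (h : T -> V) : open A -> open B ->
  {within A, continuous f} -> {within B, continuous h} ->
  {within A `&` f @^-1` B, continuous (h \o f)}.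
Proof.
move=> oA oB cf ch; have oAB := open_preim oA oB cf.
move: cf ch; rewrite !continuous_open_subspace// => cf ch x.
move=> /set_mem[Ax Bx]; apply: continuous_comp.
  by apply: cf; exact: mem_set.
by apply: ch; exact: mem_set.
Qed.

Let openT_subgroup : open [set: G] /\ subgroup [set: G].
Proof. by split; [exact: openT|exact: subgroupT]. Qed.

Fact vid_morph : {in [set: G] &, {morph id : x y / x * y}}.
Proof. by []. Qed.

Fact vid_homeo : homeomorphism_on [set: G] [set: G] id id.
Proof. by split=> //; apply: continuous_subspaceT => x; exact: cvg_id. Qed.

Definition vid : vaut G :=
  Vaut openT_subgroup openT_subgroup vid_morph vid_homeo.

Fact vinverse_morph phi :
  {in (vcod phi) &, {morph (vinv phi) : x y / x * y}}.
Proof. by move=> x y /set_mem ? /set_mem ?; exact: vinvM. Qed.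

Fact vinverse_homeo phi :
  homeomorphism_on (vcod phi) (vdom phi) (vinv phi) (vfun phi).
Proof. by case: (vfun_homeo phi) => -[? ?] [? ?] ? ?; split. Qed.

Definition vinverse phi : vaut G :=
  Vaut (vcod_open_subgroup phi) (vdom_open_subgroup phi)
    (@vinverse_morph phi) (vinverse_homeo phi).

Fact vcomp_dom phi psi :
  open (vdom psi `&` vfun psi @^-1` vdom phi) /\
  subgroup (vdom psi `&` vfun psi @^-1` vdom phi).
Proof.
split.
  by apply: open_preim; [exact: vdom_open..|case: (vfun_homeo psi)].
by apply: subgroup_preim; [exact: vdom_subgroup..|exact: vfunM].
Qed.

Fact vcomp_cod phi psi :
  open (vcod phi `&` vinv phi @^-1` vcod psi) /\
  subgroup (vcod phi `&` vinv phi @^-1` vcod psi).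
Proof.
split.
  by apply: open_preim; [exact: vcod_open..|case: (vfun_homeo phi)].
by apply: subgroup_preim; [exact: vcod_subgroup..|exact: vinvM].
Qed.

Fact vcomp_morph phi psi :
  {in vdom psi `&` vfun psi @^-1` vdom phi &,
    {morph vfun phi \o vfun psi : x y / x * y}}.
Proof.
move=> x y /set_mem[? ?] /set_mem[? ?] /=.
by rewrite (@vfunM psi)// vfunM.
Qed.

Fact vcomp_homeo phi psi :
  homeomorphism_on (vdom psi `&` vfun psi @^-1` vdom phi)
                   (vcod phi `&` vinv phi @^-1` vcod psi)
                   (vfun phi \o vfun psi) (vinv psi \o vinv phi).
Proof.
split.
- split=> _ [x [hx hy] <-] /=; split=> /=.
  + exact: vfun_cod.
  + by rewrite vfunK//; apply: vfun_cod.
  + exact: vinv_dom.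
  + by rewrite vinvK//; apply: vinv_dom.
- split=> x /set_mem[hx hy] /=.
  + by rewrite !vfunK.
  + by rewrite !vinvK.
- apply: within_comp; [exact: vdom_open..| |].
    by case: (vfun_homeo psi).
  by case: (vfun_homeo phi).
- apply: within_comp; [exact: vcod_open..| |].
    by case: (vfun_homeo phi).
  by case: (vfun_homeo psi).
Qed.

(* phi after psi, on the largest subgroup where the composite makes sense. *)
Definition vcomp phi psi : vaut G :=
  Vaut (vcomp_dom phi psi) (vcomp_cod phi psi)
    (@vcomp_morph phi psi) (vcomp_homeo phi psi).

Lemma lmulg_continuous g : continuous (fun x : G => g * x).
Proof.
move=> x; apply: (@continuous2_cvg _ _ _ _ _ _ (fun=> g) id (fun a b => a * b)).
- exact: (mulg_continuous (g, x)).
- exact: cvg_cst.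
- exact: cvg_id.
Qed.

Lemma conj_continuous g : continuous (fun x : G => g * x * g^-1).
Proof.
move=> x; apply: (@continuous2_cvg _ _ _ _ _ _ (fun y => g * y) (fun=> g^-1)
  (fun a b => a * b)); last exact: cvg_cst.
  exact: (mulg_continuous (g * x, g^-1)).
exact: lmulg_continuous.
Qed.

Fact vconj_morph g :
  {in [set: G] &, {morph (fun x => g * x * g^-1) : x y / x * y}}.
Proof. by move=> x y _ _; rewrite !mulgA mulgVK. Qed.

Fact vconj_homeo g :
  homeomorphism_on [set: G] [set: G]
    (fun x => g * x * g^-1) (fun x => g^-1 * x * g).
Proof.
split=> //.
- by split=> x _; rewrite !mulgA ?mulVg ?mulgV mul1g ?mulgK ?mulgVK.
- by apply: continuous_subspaceT; exact: conj_continuous.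
- apply: continuous_subspaceT => x.
  by have := @conj_continuous g^-1 x; rewrite invgK.
Qed.

Definition vconj g : vaut G :=
  Vaut openT_subgroup openT_subgroup (@vconj_morph g) (vconj_homeo g).

Lemma veq_refl phi : veq phi phi.
Proof.
by exists (vdom phi); split=> //; [exact: vdom_open|exact: vdom_subgroup].
Qed.

Lemma veq_sym phi psi : veq phi psi -> veq psi phi.
Proof.
case=> W [oW sW WD e]; exists W; split=> //; first by rewrite setIC.
by move=> x /e ->.
Qed.

Lemma veq_trans phi psi chi : veq phi psi -> veq psi chi -> veq phi chi.
Proof.
case=> W [oW sW WD e] [W' [oW' sW' WD' e']]; exists (W `&` W'); split.
- exact: openI.
- exact: subgroupI.
- by move=> x [/WD[? ?] /WD'[? ?]].
- by move=> x /set_mem[Wx Wx']; rewrite e ?e' ?mem_set.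
Qed.

Lemma veq_comp phi phi' psi psi' :
  veq phi phi' -> veq psi psi' -> veq (vcomp phi psi) (vcomp phi' psi').
Proof.
case=> W [oW sW WD e] [W' [oW' sW' WD' e']].
have W'D x : W' x -> vdom psi x by move/WD' => [].
exists ((vdom psi `&` vfun psi @^-1` W) `&` W'); split.
- apply: openI => //; apply: open_preim => //; first exact: vdom_open.
  by case: (vfun_homeo psi).
- apply: subgroupI => //; apply: subgroup_preim => //; last exact: vfunM.
  exact: vdom_subgroup.
- move=> x [[Dx /WD[? ?]] W'x]; have [? ?] := WD' _ W'x.
  by split; split=> //=; rewrite -e' ?mem_set.
- move=> x /set_mem[[Dx Wx] W'x] /=.
  by rewrite -e' ?mem_set// e ?mem_set.
Qed.

Lemma veq_inv phi psi : veq phi psi -> veq (vinverse phi) (vinverse psi).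
Proof.
case=> W [oW sW WD e].
have WV x : vcod phi x -> W (vinv phi x) ->
    vcod psi x /\ vinv phi x = vinv psi x.
  move=> Vx Wx; have [_ Dx] := WD _ Wx.
  have E : vfun psi (vinv phi x) = x by rewrite -e ?mem_set// vinvK.
  split; first by rewrite -E; exact: vfun_cod.
  by rewrite -[in RHS]E vfunK.
exists (vcod phi `&` vinv phi @^-1` W); split.
- apply: open_preim => //; first exact: vcod_open.
  by case: (vfun_homeo phi).
- apply: subgroup_preim => //; last exact: vinvM.
  exact: vcod_subgroup.
- by move=> x [Vx Wx]; have [] := WV _ Vx Wx.
- by move=> x /set_mem[Vx Wx] /=; have [] := WV _ Vx Wx.
Qed.

Lemma veqVl phi : veq (vcomp (vinverse phi) phi) vid.
Proof.
exists (vdom phi); split; [exact: vdom_open|exact: vdom_subgroup| |].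
  by move=> x Dx; split=> //; split=> //=; exact: vfun_cod.
by move=> x /set_mem Dx /=; rewrite vfunK.
Qed.

Lemma veq_eqfun phi psi : vdom phi = vdom psi -> vfun phi =1 vfun psi ->
  veq phi psi.
Proof.
move=> e1 e2; exists (vdom phi).
by split=> //; [exact: vdom_open|exact: vdom_subgroup|rewrite -e1 setIid].
Qed.

HB.instance Definition _ := gen_eqMixin (vaut G).
HB.instance Definition _ := gen_choiceMixin (vaut G).

Definition veqb : rel (vaut G) := fun phi psi => `[< veq phi psi >].

Lemma veqb_equiv : equiv_class_of veqb.
Proof.
split=> [phi|phi psi|psi phi chi].
- by apply/asboolP; exact: veq_refl.
- by apply/asboolP/asboolP; exact: veq_sym.
- by move=> /asboolP h1 /asboolP h2; apply/asboolP; exact: veq_trans h1 h2.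
Qed.

Canonical veqb_equiv_rel := EquivRelPack veqb_equiv.

End VirtualAutomorphisms.

Definition Comm (G : topologicalGroupType) : Type := {eq_quot @veqb G}.
HB.instance Definition _ (G : topologicalGroupType) := Choice.on (Comm G).

Section Commensurator.
Variable G : topologicalGroupType.
Implicit Types (phi psi : vaut G) (a b c : Comm G).

Definition vclass phi : Comm G := \pi_({eq_quot @veqb G}) phi.
Definition vrepr a : vaut G := repr (a : {eq_quot @veqb G}).

Lemma vreprK : cancel vrepr vclass.
Proof. by move=> a; exact: reprK. Qed.

Lemma vclassP phi psi : vclass phi = vclass psi <-> veq phi psi.
Proof. by split=> [/eqmodP/asboolP|h]; last apply/eqmodP/asboolP. Qed.

Lemma vrepr_class phi : veq (vrepr (vclass phi)) phi.
Proof. by apply/vclassP; rewrite vreprK. Qed.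

Definition comm_one : Comm G := vclass (vid G).
Definition comm_mul a b : Comm G := vclass (vcomp (vrepr a) (vrepr b)).
Definition comm_inv a : Comm G := vclass (vinverse (vrepr a)).

Lemma comm_mulE phi psi :
  comm_mul (vclass phi) (vclass psi) = vclass (vcomp phi psi).
Proof. by apply/vclassP; apply: veq_comp; exact: vrepr_class. Qed.

Lemma comm_invE phi : comm_inv (vclass phi) = vclass (vinverse phi).
Proof. by apply/vclassP; apply: veq_inv; exact: vrepr_class. Qed.

Lemma comm_mulA : associative comm_mul.
Proof.
move=> a b c; rewrite -(vreprK a) -(vreprK b) -(vreprK c) !comm_mulE.
by apply/vclassP; apply: veq_eqfun => //=; rewrite setIA.
Qed.

Lemma comm_mul1 : left_id comm_one comm_mul.
Proof.
move=> a; rewrite -(vreprK a) comm_mulE.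
by apply/vclassP; apply: veq_eqfun => //=; rewrite preimage_setT setIT.
Qed.

Lemma comm_1mul : right_id comm_one comm_mul.
Proof.
move=> a; rewrite -(vreprK a) comm_mulE.
by apply/vclassP; apply: veq_eqfun => //=; rewrite setTI.
Qed.

Lemma comm_mulV : left_inverse comm_one comm_inv comm_mul.
Proof.
move=> a; rewrite -(vreprK a) comm_invE comm_mulE.
by apply/vclassP; exact: veqVl.
Qed.

Lemma comm_Vmul : right_inverse comm_one comm_inv comm_mul.
Proof.
move=> a; rewrite -(vreprK a) comm_invE comm_mulE; apply/vclassP.
exact: (veqVl (vinverse (vrepr a))).
Qed.

HB.instance Definition _ := isGroup.Build (Comm G)
  comm_mulA comm_mul1 comm_1mul comm_mulV comm_Vmul.

Definition iota (g : G) : Comm G := vclass (vconj g).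

Lemma iotaM : {morph iota : x y / x * y}.
Proof.
move=> x y; rewrite [RHS]comm_mulE; apply/vclassP; apply: veq_eqfun => /=.
  by rewrite preimage_setT setIT.
by move=> z /=; rewrite invgM !mulgA.
Qed.

Lemma iota_ker g : iota g = 1 <-> VZ G g.
Proof.
rewrite vclassP; split=> [[W [oW sW _ e]]|Zg].
  have cW x : W x -> commute g x.
    move=> Wx; have /= := e x (mem_set Wx); move=> /(congr1 (fun z => z * g)).
    by rewrite mulgVK.
  have WC : W `<=` centralizer [set g].
    by move=> x Wx _ ->; apply/esym; exact: cW.
  rewrite /VZ/= openE => x Cx.
  have /subgroupP[W1 _ _] := sW.
  have : \forall y \near x, W (x^-1 * y).
    apply: (@lmulg_continuous G x^-1 x); apply: open_nbhs_nbhs.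
    by split=> //; rewrite mulVg.
  apply: filterS => y /WC/(_ g erefl) Cy _ ->.
  rewrite -(mulVKg x y); apply: commute_sym; apply: commuteM.
    by apply: commute_sym; exact: Cx.
  by apply: commute_sym.
exists (centralizer [set g]); split=> //.
- apply/subgroupP; split=> [_ ->|x y Cx Cy _ ->|x Cx _ ->].
  + by apply: commute_sym; exact: commute1.
  + apply: commute_sym; apply: commuteM; apply: commute_sym; first exact: Cx.
    exact: Cy.
  + by apply: commute_sym; apply: commuteV; apply: commute_sym; exact: Cx.
- by move=> x /set_mem/(_ g erefl) /= Cx; rewrite -Cx mulgK.
Qed.

End Commensurator.

(* N is identified with iota(N), and conjugates are taken inside Comm(G). *)
Definition sticky (G : topologicalGroupType) (N : set G) : Prop :=
  forall g : Comm G,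
    let M := @iota G @` N in
    let gM := conjset g M in
    finite_index (M `&` gM) M /\ finite_index (M `&` gM) gM.

Definition envelope (G L : topologicalGroupType) (eta : G -> L) : Prop :=
  [/\ {morph eta : x y / x * y}, injective eta, open (range eta)
    & exists eta' : L -> G,
        homeomorphism_on [set: G] (range eta) eta eta'].

Definition compactly_generated (L : topologicalGroupType) : Prop :=
  exists2 K : set L, compact K & smallest (@subgroup L) K = [set: L].

Definition topologically_simple (L : topologicalGroupType) : Prop :=
  [set: L] <> [set 1] /\
  forall M : set L, closed M -> normal_subgroup M ->
    M = [set 1] \/ M = [set: L].

(* Main.v *)
(* Identify G with an open subgroup of an envelope L. Stickiness says that N is
   commensurated by L, so the elements of L centralizing a neighbourhood of 1
   in N form a normal subgroup C of L; it contains the centralizer of N, hence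
   is dense when L is topologically simple, and L = C G. A compact generating
   set then lies in S G, where all elements of S centralize the same
   neighbourhood of 1 in N. The elements of N all of whose G-conjugates commute
   with S form a closed subgroup Q normalized by S and G, hence normal in L. If
   Q = 1 then N is discrete, so N lies in VZ(G); if Q = L then N = G has
   non-trivial center, again inside VZ(G). *)
Require Import Defs.
From HB Require Import structures.
From mathcomp Require Import all_boot.
From mathcomp Require Import boolp classical_sets functions cardinality topology.

Set Implicit Arguments.
Unset Strict Implicit.
Unset Printing Implicit Defensive.

Local Open Scope classical_set_scope.
Local Open Scope group_scope.

(** * Subgroups, closures and conjugation in topological groups *)

Section TopologicalGroups.
Variable G : topologicalGroupType.
Implicit Types (A H K : set G) (g x y : G).

Lemma continuousMg (T : topologicalType) (f h : T -> G) :
  continuous f -> continuous h -> continuous (fun s => f s * h s).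
Proof.
move=> cf ch t.
apply: (@continuous2_cvg _ _ _ _ _ _ f h (fun a b => a * b)).
- exact: (mulg_continuous (f t, h t)).
- exact: cf.
- exact: ch.
Qed.

Lemma continuousVg (T : topologicalType) (f : T -> G) :
  continuous f -> continuous (fun s => (f s)^-1).
Proof.
by move=> cf t; apply: continuous_comp; [exact: cf|exact: invg_continuous].
Qed.

Lemma rmulg_continuous g : continuous (fun x => x * g).
Proof. by apply: continuousMg => x; [exact: cvg_id|exact: cvg_cst]. Qed.

Lemma nbhs_lcoset A g : nbhs 1 A -> nbhs g [set x | A (g^-1 * x)].
Proof.
by move=> nA; apply: (@lmulg_continuous G g^-1 g); rewrite mulVg.
Qed.

Lemma subgroup_open H : subgroup H -> nbhs 1 H -> open H.
Proof.
move=> /subgroupP[_ HM _] nH; rewrite openE => x Hx.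
apply: filterS (nbhs_lcoset x nH) => y /= Hy.
by rewrite -(mulVKg x y); exact: HM.
Qed.

Lemma open_subgroup_nbhs H : open H -> subgroup H -> nbhs 1 H.
Proof. by move=> oH /subgroupP[H1 _ _]; exact: open_nbhs_nbhs. Qed.

Lemma open_subgroup_closed H : open H -> subgroup H -> closed H.
Proof.
move=> oH sH; rewrite -[H]setCK; apply: open_closedC.
have nH := open_subgroup_nbhs oH sH.
move/subgroupP: sH => [_ HM HV]; rewrite openE => x nHx.
apply: filterS (nbhs_lcoset x nH) => y /= Hxy Hy; apply: nHx.
by rewrite -(invgK x); apply/HV; rewrite -(mulgK y x^-1); apply/HM/HV.
Qed.

(** The preimage of [closure A] under [f] is closed and contains [A]. Through this, algebraic
    closure properties pass from a subgroup to its closure, one variable at a time. *)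
Lemma closure_homo A (f : G -> G) : continuous f ->
  (forall x, A x -> closure A (f x)) -> forall x, closure A x -> closure A (f x).
Proof.
move=> /continuous_closedP cf fA.
rewrite -/(closure A `<=` f @^-1` closure A) [X in X `<=` _]closureE.
by apply: smallest_sub => //; apply: cf; exact: closed_closure.
Qed.

Lemma closure_subgroup H : subgroup H -> subgroup (closure H).
Proof.
move=> /subgroupP[H1 HM HV]; apply/subgroupP.
have cH := @subset_closure _ H.
split=> [|x y cx cy|]; first exact: cH.
  apply: (@closure_homo H (fun z => z * y)) cx => [|z Hz].
    exact: rmulg_continuous.
  apply: (@closure_homo H (fun t => z * t)) cy => [|t Ht].
    exact: lmulg_continuous.
  by apply: cH; exact: HM.
apply: closure_homo; first exact: invg_continuous.
by move=> x Hx; apply: cH; exact: HV.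
Qed.

Lemma normal_subgroupP H : subgroup H ->
  (forall g x, H x -> H (g * x * g^-1)) -> normal_subgroup H.
Proof.
move=> sH cH; split=> // g; apply/seteqP; split=> [_ [x Hx <-]|x Hx].
  exact: cH.
exists (g^-1 * x * g); first by rewrite -{2}(invgK g); exact: cH.
by rewrite !mulgA mulgV mul1g mulgK.
Qed.

Lemma normal_conj H g x : normal_subgroup H -> H x -> H (g * x * g^-1).
Proof. by move=> [_ eH] Hx; rewrite -(eH g); exists x. Qed.

Lemma closure_normal H : normal_subgroup H -> normal_subgroup (closure H).
Proof.
move=> nH; apply: normal_subgroupP; first exact: closure_subgroup nH.1.
move=> g; apply: closure_homo; first exact: conj_continuous.
by move=> x Hx; apply: subset_closure; exact: normal_conj.
Qed.

(** A tube argument: [(g, x) |-> g * x * g^-1] sends every [(g, 1)] to 1, and compactness makes the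
    neighbourhood of 1 uniform in [g]. *)
Lemma compact_conj_nbhs V : compact [set: G] -> nbhs 1 V ->
  \forall x \near (1 : G), forall g, V (g * x * g^-1).
Proof.
move=> /compact_near_coveringP cG nV.
have := cG G (nbhs 1) (fun x g => V (g * x * g^-1)) _ _.
move=> /(_ _ _)/filterS; apply => // [x h g|g _]; first exact: h.
have : continuous (fun p : G * G => p.1 * p.2 * p.1^-1).
  apply: continuousMg; first exact: mulg_continuous.
  by apply: continuousVg => p; exact: cvg_fst.
by move=> /(_ (g, 1)); apply; rewrite /= mulg1 mulgV.
Qed.

Lemma centralizer1_subgroup g : subgroup (centralizer [set g]).
Proof.
apply/subgroupP; split=> [_ ->|x y Cx Cy _ ->|x Cx _ ->]; apply: commute_sym.
- exact: commute1.
- by apply: commuteM; apply: commute_sym; [exact: Cx|exact: Cy].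
- by apply: commuteV; apply: commute_sym; exact: Cx.
Qed.

(** For fixed [x] in [N], the commutator of [g] and [x] lies in [N] and tends to 1 as [g] tends to
    1, so it is trivial for [g] near 1. *)
Lemma discrete_normal_VZ N : normal_subgroup N ->
  (\forall x \near (1 : G), N x -> x = 1) -> N `<=` VZ G.
Proof.
move=> nN d x Nx; apply: subgroup_open; first exact: centralizer1_subgroup.
have cc : continuous (fun g => g * x * g^-1 * x^-1).
  apply: continuousMg => [|g]; last exact: cvg_cst.
  apply: continuousMg; first exact: rmulg_continuous.
  exact: invg_continuous.
have nx : nbhs 1 [set g | N (g * x * g^-1 * x^-1) -> g * x * g^-1 * x^-1 = 1].
  by apply: (cc 1 [set z | N z -> z = 1]); rewrite mul1g invg1 mulg1 mulgV.
apply: filterS nx => g /= h _ ->; rewrite /commute.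
have /subgroupP[_ NM NV] := nN.1.
have /h/(congr1 (fun z => z * x * g)) : N (g * x * g^-1 * x^-1).
  by apply: NM; [exact: normal_conj|exact: NV].
by rewrite !mulgVK mul1g.
Qed.

End TopologicalGroups.

(** [X] carries no topology (it will be [Comm G]), so closedness is asked of the pullback of [H] to
    [K] and [D]. A coset of [H] pulls back to the empty set or to a translate of that closed set,
    and there are finitely many cosets. *)
Lemma finite_index_nbhs (G : topologicalGroupType) (X : groupType)
    (f : G -> X) (K D : set G) (H : set X) :
    {morph f : x y / x * y} -> open D -> subgroup D -> subgroup K ->
    subgroup H -> finite_index H (f @` K) -> closed (K `&` D `&` f @^-1` H) ->
  \forall x \near (1 : G), K x -> H (f x).
Proof.
move=> fM oD sD sK /subgroupP[H1 HM HV] fin clH.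
have sKD := subgroupI sK sD.
have nD := open_subgroup_nbhs oD sD.
pose cosets := [set [set k * h | h in H] | k in f @` K].
(* The cosets of [H] missing 1 pull back to a closed set [F] missing 1. *)
pose F := \bigcup_(A in cosets `&` [set A | ~ A 1]) (K `&` D `&` f @^-1` A).
have clF : closed F.
  apply: closed_bigcup => [|A [[h _ <-] _]]; first exact: finite_setIl.
  have [->|/set0P[d [KDd [a Ha fd]]]] := eqVneq
      (K `&` D `&` f @^-1` [set h * y | y in H]) set0; first exact: closed0.
  suff -> : K `&` D `&` f @^-1` [set h * y | y in H] =
      (fun x => d^-1 * x) @^-1` (K `&` D `&` f @^-1` H).
    apply: ((continuous_closedP _).1 _ _ clH); exact: lmulg_continuous.
  have /subgroupP[_ KDM KDV] := sKD.
  have fE x : f x = f d * f (d^-1 * x) by rewrite -fM mulVKg.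
  apply/seteqP; split=> x /=.
    move=> [KDx [b Hb fx]]; split; first by apply: KDM => //; exact: KDV.
    apply: (_ : H (f (d^-1 * x))).
    have <- : a^-1 * b = f (d^-1 * x); last by apply: HM => //; exact: HV.
    by apply: (@mulgI _ (f d)); rewrite -fE -fx -fd -mulgA mulVKg.
  move=> [KDx Hx]; split; first by rewrite -(mulVKg d x); exact: KDM.
  by exists (a * f (d^-1 * x)); [exact: HM|rewrite mulgA fd -fE].
have nF : nbhs 1 (~` F).
  apply: open_nbhs_nbhs; split; first exact: closed_openC.
  move=> [A [_ /= nA] [_ fA]]; apply: nA.
  suff <- : f 1 = 1 by [].
  by apply: (@mulgI _ (f 1)); rewrite -fM !mulg1.
near=> x => Kx.
have Dx : D x by near: x.
have nFx : ~ F x by near: x.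
have : [set f x * y | y in H] 1.
  apply: contrapT => n1; apply: nFx; exists [set f x * y | y in H].
    by split=> //; exists (f x) => //; exists x.
  by split=> //; exists 1; rewrite ?mulg1.
move=> [y Hy e]; rewrite -(invgK (f x)); apply: HV.
by rewrite -(mulg1 (f x)^-1) -e mulKg.
Unshelve. all: by end_near.
Qed.

(** * Stickiness expressed by virtual automorphisms *)

Section Sticky.
Variable G : topologicalGroupType.
Implicit Types (N : set G) (phi : vaut G).

Lemma iota_inj : VZ G = [set 1] -> injective (@Defs.iota G).
Proof.
move=> VZ1 x y e; have : VZ G (x * y^-1).
  by apply/iota_ker; rewrite iotaM e -iotaM mulgV; apply/iota_ker; rewrite VZ1.
by rewrite VZ1 => /= /(congr1 (fun z => z * y)); rewrite mulgVK mul1g.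
Qed.

(** Since [phi] is multiplicative, [phi] after conjugation by [x] agrees on its domain with
    conjugation by [vfun phi x] after [phi]. Conjugates in [Comm G] can thus be computed inside
    [G]. *)
Lemma vclass_conj phi x : vdom phi x ->
  vclass phi * Defs.iota x * (vclass phi)^-1 = Defs.iota (vfun phi x).
Proof.
move=> Dx; apply: (@mulIg _ (vclass phi)); rewrite mulgVK.
rewrite [LHS]comm_mulE [RHS]comm_mulE; apply/vclassP.
have /subgroupP[_ DM DV] := vdom_subgroup phi.
exists (vdom phi); split; [exact: vdom_open|exact: vdom_subgroup| |].
  move=> y Dy; split; split=> //=.
  by apply: (DM); [exact: DM|exact: DV].
move=> y /set_mem Dy /=.
have [_ fV] := morph_on1V (vdom_subgroup phi) (@vfunM _ phi).
have DxV := DV _ Dx.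
by rewrite !vfunM ?fV//; apply: DM.
Qed.

(** Conjugation by the class of [phi] maps [N] onto its conjugate in [Comm G], in which the
    intersection with [N] has finite index; [finite_index_nbhs] then applies. *)
Lemma sticky_nbhs N phi : VZ G = [set 1] -> closed N -> subgroup N ->
    sticky N ->
  \forall x \near (1 : G), N x -> vdom phi x /\ N (vfun phi x).
Proof.
move=> VZ1 clN sN stN.
have [oD sD] := vdom_open_subgroup phi.
have clD := open_subgroup_closed oD sD.
pose f (x : G) := vclass phi * Defs.iota x * (vclass phi)^-1.
have fM : {morph f : x y / x * y}.
  by move=> x y; rewrite /f iotaM !mulgA mulgVK.
pose M := @Defs.iota G @` N; pose gM := conjset (vclass phi) M.
have fN : f @` N = gM by rewrite /gM /conjset /M image_comp.
have i1 : Defs.iota 1 = 1 :> Comm G by apply/iota_ker; rewrite VZ1.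
have iV x : Defs.iota x^-1 = (Defs.iota x)^-1 :> Comm G.
  by apply: (@mulgI _ (Defs.iota x)); rewrite -iotaM !mulgV.
have sM : subgroup M.
  move/subgroupP: sN => [N1 NM NV]; apply/subgroupP; split.
  - by exists 1.
  - move=> _ _ [x Nx <-] [y Ny <-].
    by exists (x * y); rewrite ?iotaM//; exact: NM.
  - by move=> _ [x Nx <-]; exists x^-1; rewrite ?iV//; exact: NV.
have sgM : subgroup gM.
  rewrite -fN; move/subgroupP: sN => [N1 NM NV]; apply/subgroupP; split.
  - by exists 1; rewrite // /f i1 mulg1 mulgV.
  - by move=> _ _ [x Nx <-] [y Ny <-]; exists (x * y); rewrite ?fM//; exact: NM.
  - move=> _ [x Nx <-]; exists x^-1; first exact: NV.
    by rewrite /f iV !invgM invgK mulgA.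
have cl : closed (N `&` vdom phi `&` f @^-1` (M `&` gM)).
  (* As [phi] is continuous only on its domain, closedness comes from removing from this clopen
     subgroup the open set of points sent outside [N]. *)
  have -> : N `&` vdom phi `&` f @^-1` (M `&` gM) =
      N `&` (vdom phi `\` (vdom phi `&` vfun phi @^-1` (~` N))).
    apply/seteqP; split=> x /=.
      move=> [[Nx Dx] [[y Ny e] _]]; split=> //; split=> // -[_]; apply.
      by move: e; rewrite /f vclass_conj// => /(iota_inj VZ1) <-.
    move=> [Nx [Dx h]]; split=> //; split; last by rewrite -fN; exists x.
    rewrite /f vclass_conj//; exists (vfun phi x) => //.
    by apply: contrapT => h'; apply: h.
  apply: closedI => //; rewrite setDE; apply: closedI => //.
  apply: open_closedC; apply: open_preim => //; first exact: closed_openC.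
  by case: (vfun_homeo phi).
have fin : finite_index (M `&` gM) (f @` N) by rewrite fN; exact: (stN _).2.
have nD := open_subgroup_nbhs oD sD.
have h := finite_index_nbhs fM oD sD sN (subgroupI sM sgM) fin cl.
near=> x => Nx; have Dx : vdom phi x by near: x.
split=> //; have : (M `&` gM) (f x) by move: Nx; near: x.
by rewrite /f vclass_conj// => -[[y Ny /(iota_inj VZ1) <-]].
Unshelve. all: by end_near.
Qed.

End Sticky.

(** * Envelopes and the elements centralizing [N] near the identity *)

Section Envelope.
Variables (G L : topologicalGroupType) (eta : G -> L).
Hypothesis env : envelope eta.
Implicit Types (N Q : set G) (g : L) (x y : G).

Lemma envelopeM : {morph eta : x y / x * y}.
Proof. by case: env. Qed.

Lemma envelope_inj : injective eta.
Proof. by case: env. Qed.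

Lemma envelope1 : eta 1 = 1.
Proof. by apply: (@mulgI _ (eta 1)); rewrite -envelopeM !mulg1. Qed.

Lemma envelopeV x : eta x^-1 = (eta x)^-1.
Proof. by apply: (@mulgI _ (eta x)); rewrite -envelopeM !mulgV envelope1. Qed.

Lemma envelope_continuous : continuous eta.
Proof.
case: env => _ _ _ [eta' [_ _ + _]].
rewrite continuous_open_subspace; last exact: openT.
by move=> c x; apply: c; rewrite inE.
Qed.

Lemma envelope_image_subgroup Q : subgroup Q -> subgroup (eta @` Q).
Proof.
move=> /subgroupP[Q1 QM QV]; apply/subgroupP; split.
- by exists 1; rewrite ?envelope1.
- move=> _ _ [x Qx <-] [y Qy <-]; exists (x * y); first exact: QM.
  by rewrite envelopeM.
- by move=> _ [x Qx <-]; exists x^-1; rewrite ?envelopeV//; exact: QV.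
Qed.

Lemma envelope_image_open Q : open Q -> open (eta @` Q).
Proof.
move=> oQ; case: env => _ _ oR [eta' [_ [/= eK _] _ ce']].
suff -> : eta @` Q = range eta `&` eta' @^-1` Q by exact: open_preim.
apply/seteqP; split=> [_ [x Qx <-]|_ [[x _ <-] /=]].
  by split; [exists x|rewrite /= eK ?inE].
by rewrite eK ?inE// => Qx; exists x.
Qed.

Lemma envelope_image_closed Q : closed Q -> closed (eta @` Q).
Proof.
move=> cQ; have sT := envelope_image_subgroup (@subgroupT G).
have oT := envelope_image_open (@openT G).
suff -> : eta @` Q = range eta `\` eta @` (~` Q).
  rewrite setDE; apply: closedI; first exact: open_subgroup_closed.
  exact/open_closedC/envelope_image_open/closed_openC.
apply/seteqP; split=> [_ [x Qx <-]|_ [[x _ <-] nQ]].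
  by split; [exists x|move=> [y nQ /envelope_inj e]; apply: nQ; rewrite e].
by exists x => //; apply: contrapT => nQx; apply: nQ; exists x.
Qed.

(** Conjugation by [g] pulls back to the points of [G] whose conjugate stays in [range eta]. They
    form an open subgroup because [range eta] is open, and conjugation by [g^-1] gives the
    inverse. *)
Lemma envelope_conj g : exists phi : vaut G,
  forall x, vdom phi x -> eta (vfun phi x) = g * eta x * g^-1.
Proof.
have [_ _ oR [eta' [_ [/= eK Ke] ce ce']]] := env.
have sR := envelope_image_subgroup (@subgroupT G).
pose c h x := h * eta x * h^-1.
pose D h := [set x | range eta (c h x)].
pose f h x := eta' (c h x).
have cM h : {morph c h : x y / x * y}.
  by move=> x y; rewrite /c envelopeM !mulgA mulgVK.
have cc h : continuous (c h).
  apply: continuousMg => [|x]; last exact: cvg_cst.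
  by apply: continuousMg => [x|]; [exact: cvg_cst|exact: envelope_continuous].
have fE h x : D h x -> eta (f h x) = c h x.
  by move=> Dx; rewrite Ke ?inE.
have odom h : open (D h) /\ subgroup (D h).
  split; first by move/continuousP: (cc h); apply; exact: oR.
  move/subgroupP: sR => [R1 RM RV]; apply/subgroupP; split.
  - by rewrite /D /= /c envelope1 mulg1 mulgV.
  - by move=> x y Dx Dy; rewrite /D /= cM; exact: RM.
  - move=> x Dx; rewrite /D /=.
    suff <- : (c h x)^-1 = c h x^-1 by exact: RV.
    by rewrite /c !invgM invgK envelopeV mulgA.
have inv h x : D h x -> D h^-1 (f h x) /\ f h^-1 (f h x) = x.
  move=> Dx; have e : c h^-1 (f h x) = eta x.
    by rewrite /c fE// /c invgK !mulgA mulVg mul1g mulgVK.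
  split; first by rewrite /D /= e; exists x.
  by rewrite /f e eK ?inE.
have inv' x : D g^-1 x -> D g (f g^-1 x) /\ f g (f g^-1 x) = x.
  by move=> /inv; rewrite invgK.
have fM : {in D g &, {morph f g : x y / x * y}}.
  move=> x y /set_mem Dx /set_mem Dy; apply: envelope_inj.
  have /subgroupP[_ DM _] := (odom g).2.
  by rewrite fE ?cM ?envelopeM ?fE//; exact: DM.
have fc h : {within D h, continuous (f h)}.
  have := @within_comp _ _ _ [set: G] (range eta) (c h) eta' openT oR.
  by rewrite setTI; apply => //; exact/continuous_subspaceT/cc.
have fh : homeomorphism_on (D g) (D g^-1) (f g) (f g^-1).
  split; [split|split| |].
  - by move=> _ [x /inv[? _] <-].
  - by move=> _ [x /inv'[? _] <-].
  - by move=> x /set_mem/inv[].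
  - by move=> x /set_mem/inv'[].
  - exact: fc.
  - exact: fc.
by exists (Vaut (odom g) (odom g^-1) fM fh) => x /= /fE.
Qed.

(** The neighbourhood may depend on [c], so this set is not visibly closed; simplicity will be
    applied to its closure. *)
Definition virtual_centralizer N : set L :=
  [set c | \forall x \near (1 : G), N x -> commute c (eta x)].

(** If [x] in [N] tends to 1, its conjugate by [g^-1] tends to 1 and, by stickiness, eventually lies
    in [N]. There it commutes with [c]; conjugating back by [g] gives the claim. *)
Lemma virtual_centralizer_normal N : VZ G = [set 1] -> closed N ->
  subgroup N -> sticky N -> normal_subgroup (virtual_centralizer N).
Proof.
move=> VZ1 clN sN stN; apply: normal_subgroupP.
  apply/subgroupP; split.
  - by apply: nearW => x _; apply: commute_sym; exact: commute1.
  - move=> c d Cc Cd; apply: filterS2 Cc Cd => x cx dx Nx.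
    by apply: commute_sym; apply: commuteM; apply: commute_sym; auto.
  - move=> c Cc; apply: filterS Cc => x cx Nx.
    by apply: commute_sym; apply: commuteV; apply: commute_sym; auto.
move=> g c Cc; have [phi phiE] := envelope_conj g^-1.
have cphi : vfun phi x @[x --> (1 : G)] --> (1 : G).
  have [f1 _] := morph_on1V (vdom_subgroup phi) (@vfunM _ phi).
  rewrite -[X in _ --> X]f1.
  have [_ _ + _] := vfun_homeo phi.
  rewrite (continuous_open_subspace _ (vdom_open phi)); apply.
  by apply/mem_set; have /subgroupP[] := vdom_subgroup phi.
have near1 := sticky_nbhs phi VZ1 clN sN stN.
have near2 := cphi _ Cc.
apply: filterS2 near1 near2 => x /= Nphi cx Nx.
have [Dx /cx] := Nphi Nx; rewrite phiE// invgK /commute => e.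
have {e} := congr1 (fun z => g * z * g^-1) e.
by rewrite !mulgA mulgV mul1g mulgK.
Qed.

End Envelope.

(** * Closed normal subgroups of a simple envelope *)

Theorem theorem4p9 (G : topologicalGroupType) (N : set G) :
  profinite G ->
  VZ G = [set 1] ->
  closed N ->
  normal_subgroup N ->
  N <> [set 1] ->
  sticky N ->
  centralizer N <> [set 1] ->
  ~ exists (L : topologicalGroupType) (eta : G -> L),
      [/\ envelope eta, compactly_generated L & topologically_simple L].
Proof.
move=> [cptG hausG _] VZ1 clN nN N1 stN CN1.
move=> [L [eta [env [K cptK genK] [_ simL]]]].
have sN := nN.1; have /subgroupP[N_1 NM NV] := sN.
have etaM := envelopeM env; have etaV := envelopeV env.
have eta_inj := envelope_inj env.
have [z Cz z1] : exists2 z, centralizer N z & z <> 1.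
  apply: contrapT => h; apply: CN1; apply/seteqP; split=> [z Cz|_ ->].
    by apply: contrapT => z1; apply: h; exists z.
  by move=> x _; apply: commute_sym; exact: commute1.
pose C := virtual_centralizer eta N.
have nC : normal_subgroup C by exact: virtual_centralizer_normal.
(* [eta z] is a non-trivial element of [C], which excludes the trivial closure. *)
have denseC : closure C = [set: L].
  have [] // := simL _ (@closed_closure _ C) (closure_normal nC).
  move=> /seteqP[clC _]; exfalso; apply: z1; apply: eta_inj.
  rewrite (envelope1 env); apply: clC; apply: subset_closure.
  by apply: nearW => x Nx; rewrite /commute -!etaM (Cz x Nx).
have near1 : nbhs 1 (range eta).
  apply: open_subgroup_nbhs; first exact: envelope_image_open openT.
  exact: envelope_image_subgroup (@subgroupT G).
(* The open coset of [range eta] through [l] meets the dense set [C], so one representative [c]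
   serves all [k] near [l]. *)
have near_coset (l : L) : exists2 c, C c &
    \forall k \near l, exists g, k = c * eta g.
  have : closure C l by rewrite denseC.
  move=> /(_ _ (nbhs_lcoset l near1))[c [Cc [g _ /(congr1 (fun z => l * z))]]].
  rewrite mulVKg => ec; exists c => //.
  apply: filterS (nbhs_lcoset l near1) => k [h _ /(congr1 (fun z => l * z))].
  rewrite mulVKg => <-; exists (g^-1 * h).
  by rewrite -ec etaM etaV mulgA mulgK.
pose S (V : set G) : set L :=
  [set c | forall x, V x -> N x -> commute c (eta x)].
(* Shrinking [V] enlarges [S V], so the property holds for all small [V] once it holds for one;
   compactness of [K] then makes the local choices uniform. *)
have [V nV KV] : exists2 V : set G, nbhs 1 V &
    forall k, K k -> exists c g, S V c /\ k = c * eta g.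
  have /compact_near_coveringP cvK := cptK.
  apply/near_powerset_filter_fromP.
    move=> A B AB SB k /SB[c [g [Sc e]]]; exists c, g; split=> // x /AB.
    exact: Sc.
  pose P (V : set G) k := exists c g, S V c /\ k = c * eta g.
  apply: (cvK _ (powerset_filter_from (nbhs 1)) P) => l _.
  have [c Cc nl] := near_coset l.
  exists ([set k | exists g, k = c * eta g],
          [set W : set G | W `<=` [set x | N x -> commute c (eta x)]]).
    by split=> //=; exact: small_set_sub.
  by move=> [k W] [/= [g ->] WC]; exists c, g; split=> // x /WC.
pose Q : set G :=
  N `&` [set x | forall g c, S V c -> commute c (eta (g * x * g^-1))].
have sQ : subgroup Q.
  apply/subgroupP; split.
  - split=> // g c _; rewrite mulg1 mulgV (envelope1 env); exact: commute1.
  - move=> x y [Nx Qx] [Ny Qy]; split; first exact: NM.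
    move=> g c Sc; rewrite (_ : _ / g = (g * x * g^-1) * (g * y * g^-1)).
      by rewrite etaM; apply: commuteM; auto.
    by rewrite !mulgA mulgVK.
  - move=> x [Nx Qx]; split; first exact: NV.
    move=> g c Sc; rewrite (_ : _ / g = (g * x * g^-1)^-1).
      by rewrite etaV; apply: commuteV; auto.
    by rewrite !invgM invgK mulgA.
have QJ g x : Q x -> Q (g * x * g^-1).
  move=> [Nx Qx]; split; first exact: normal_conj.
  move=> h c /(Qx (h * g) c).
  by rewrite invgM !mulgA.
(* [L] is not assumed Hausdorff: closedness of the trivial subgroup is inherited from [G]. *)
have clL1 : closed [set (1 : L)].
  rewrite -(envelope1 env) -image_set1; apply: envelope_image_closed => //.
  exact/accessible_closed_set1/hausdorff_accessible.
have clQ : closed Q.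
  apply: closedI => //.
  (* Commuting is rewritten as a trivial commutator, which is a closed condition. *)
  rewrite (_ : [set x | _] = \bigcap_(g in [set: G]) \bigcap_(c in S V)
    ((fun x => c * eta (g * x * g^-1) * c^-1 * (eta (g * x * g^-1))^-1)
       @^-1` [set 1])).
    apply: closed_bigI => g _; apply: closed_bigI => c _.
    have ce : continuous (fun x => eta (g * x * g^-1)).
      move=> x; apply: (@continuous_comp _ _ _ (fun x => g * x * g^-1) eta).
        exact: conj_continuous.
      exact: envelope_continuous.
    apply: ((continuous_closedP _).1 _ _ clL1).
    apply: continuousMg; last exact: continuousVg.
    apply: continuousMg => [|x]; last exact: cvg_cst.
    by apply: continuousMg => // x; exact: cvg_cst.
  apply/seteqP; split=> x /= h.
    by move=> g _ c Sc /=; rewrite (h g c Sc) mulgK mulgV.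
  move=> g c Sc; have /= := h g I c Sc.
  move=> /(congr1 (fun z => z * eta (g * x * g^-1) * c)).
  by rewrite !mulgVK mul1g.
have nQ : normal_subgroup (eta @` Q).
  have sP := envelope_image_subgroup env sQ.
  pose Z : set L := [set l | conjset l (eta @` Q) = eta @` Q].
  have sZ : subgroup Z.
    have conjM (a b : L) A : conjset a (conjset b A) = conjset (a * b) A.
      rewrite /conjset image_comp; apply: eq_imagel => x _ /=.
      by rewrite invgM !mulgA.
    have conj1 (A : set L) : conjset 1 A = A.
      rewrite /conjset -[RHS]image_id; apply: eq_imagel => x _.
      by rewrite mul1g invg1 mulg1.
    apply/subgroupP; split; first exact: conj1.
      by move=> a b Za Zb; rewrite /Z /= -conjM Zb.
    by move=> a Za; rewrite /Z /= -{1}Za conjM mulVg conj1.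
  suff ZT : Z = [set: L] by split=> // l; have : Z l by rewrite ZT.
  apply/seteqP; split=> // l _.
  have : smallest (@subgroup L) K l by rewrite genK.
  apply: smallest_sub => //.
  move=> k /KV[c [g [Sc ->]]]; have /subgroupP[_ ZM _] := sZ; apply: ZM.
    rewrite /Z /= /conjset -[RHS]image_id; apply: eq_imagel => _ [x [Nx Qx] <-].
    by have := Qx 1 c Sc; rewrite mul1g invg1 mulg1 => ->; rewrite mulgK.
  apply/seteqP; split=> [_ [_ [x Qx <-] <-]|_ [x Qx <-]].
    by exists (g * x * g^-1); [exact: QJ|rewrite !etaM etaV].
  exists (eta (g^-1 * x * g)).
    by exists (g^-1 * x * g) => //; rewrite -{2}(invgK g); exact: QJ.
  by rewrite -etaV -!etaM !mulgA mulgV mul1g mulgK.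
case: (simL _ (envelope_image_closed env clQ) nQ) => [Q1|QT].
  apply: N1; apply/seteqP; split=> [x Nx|_ ->//].
  rewrite -VZ1; apply: (discrete_normal_VZ nN) Nx.
  (* An element of [N] whose conjugates all lie in [V] belongs to [Q], hence is trivial. *)
  apply: filterS (compact_conj_nbhs cptG nV) => y Vy Ny.
  apply: eta_inj; rewrite (envelope1 env).
  suff : (eta @` Q) (eta y) by rewrite Q1.
  exists y => //; split=> // g c Sc; apply: Sc; first exact: Vy.
  exact: normal_conj.
(* Here [Q], and so [N], is all of [G]; thus [z] is central and its centralizer is open. *)
apply: z1; suff : VZ G z by rewrite VZ1.
rewrite /VZ /= (_ : centralizer _ = [set: G]); first exact: openT.
apply/seteqP; split=> // x _ _ ->; apply: commute_sym; apply: Cz.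
have [y [Ny _] /eta_inj <-//] : (eta @` Q) (eta x) by rewrite QT.
Qed.
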